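(* Fix an integer $d\ge 2$. Let $e$ be any edge of the Kautz digraph $K(d,D)$ whose edge-word $w(e)$ is an unbordered $7/4^{+}$-power-free ternary word of length $D+1$ (over $\{0,1,2\}$, viewed inside the alphabet $[d+1]$). Then with the explicit constant \[ C_d:=\frac{8}{d-1}, \] we have \[ U_D(e)\ \ge\ (D-C_d)\,d^{D-1} \qquad\text{and}\qquad \mathrm{cong}(e)\ \ge\ \frac{d}{d-1}\Bigl(1-\frac{1}{D(d-1)}\Bigr)(D-C_d)\,d^{D-1}. \] Consequently, whenever $D\ge \frac{8d^2+2d-1}{d-1}$ we have $\mathrm{cong}(e)>\tau(d,D)$, where $\tau(d,D)=(D-1)d^{D-2}+D\,d^{D-1}$.
   Context: Write $[n]=\{0,1,\dots,n-1\}$. The Kautz digraph $K(d,D)$ has as vertices all words $x_0\cdots x_{D-1}$ of length $D$ over $[d+1]$ with $x_i\ne x_{i+1}$ for all $i$, and directed edges $x_0x_1\cdots x_{D-1}\to x_1\cdots x_{D-1}x_D$ for $x_D\in[d+1]\setminus\{x_{D-1}\}$. Every ordered pair of distinct vertices is joined by a unique shortest directed path (geodesic). An edge $e:u\to v$ with $u=a_0\cdots a_{D-1}$, $v=a_1\cdots a_D$ has edge-word $w(e)=a_0a_1\cdots a_D$. For $1\le t\le k\le D$, $N(e;k,t)$ is the number of ordered vertex pairs $(x,y)$ at directed distance $\mathrm{dist}(x,y)=k$ whose unique geodesic from $x$ to $y$ has $e$ as its $t$-th edge. Put $U_k(e)=\sum_{t=1}^k N(e;k,t)$ and $\mathrm{cong}(e)=\sum_{k=1}^D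 U_k(e)$ (the number of geodesics using $e$). A word $a_0\cdots a_D$ is unbordered if there is no $\ell$ with $1\le\ell\le D$ such that $a_0\cdots a_{\ell-1}=a_{D-\ell+1}\cdots a_D$. A word is $\alpha^{+}$-free (also called $\alpha^{+}$-power-free) if it contains no contiguous subword $x^ky$, with $x$ nonempty, $k\ge1$ an integer and $y$ a possibly empty prefix of $x$, such that $|x^ky|/|x|>\alpha$. *)

(* Defs.v *)
From HB Require Import structures.
From mathcomp Require Import all_boot all_order all_algebra.

Set Implicit Arguments.
Unset Strict Implicit.
Unset Printing Implicit Defensive.

Import Order.TTheory GRing.Theory Num.Theory.

Section Words.
Variable T : eqType.
Implicit Types w x y : seq T.

Definition adjacent_distinct w : bool := sorted (fun a b => a != b) w.

(* For w = a_0 ... a_D, size w = D + 1, so drop (size w - l) w is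
   a_{D-l+1} ... a_D. *)
Definition unbordered w : Prop :=
  forall l : nat, 1 <= l < size w -> take l w <> drop (size w - l) w.

Definition plus_power_free (alpha : rat) w : Prop :=
  forall x y (k : nat),
    x <> [::] -> 0 < k -> prefix y x ->
    let z := flatten (nseq k x) ++ y in
    infix z w -> ((size z)%:R / (size x)%:R <= alpha)%R.

End Words.

Section Digraph.
Variables (V : finType) (r : rel V).

(* A walk from x to y is given by the sequence p of its vertices after x,
   so that its length is size p. *)
Definition is_walk (x : V) (p : seq V) (y : V) : bool :=
  path r x p && (last x p == y).

(* Length of a shortest walk from x to y; a reachable vertex is at distance
   less than #|V|, and the value is #|V| if y is not reachable from x. *)
Definition dist (x y : V) : nat :=
  find (fun n => [exists p : n.-tuple V, is_walk x p y]) (iota 0 #|V|).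

Definition is_geodesic (x : V) (p : seq V) (y : V) : bool :=
  is_walk x p y && (size p == dist x y).

Definition walk_edges (x : V) (p : seq V) : seq (V * V) := zip (x :: p) p.

(* In a Kautz digraph geodesics are unique, so "some geodesic" below is
   "the geodesic". The t-th edge is counted from t = 1. *)
Definition geodesic_count (e : V * V) (k t : nat) : nat :=
  #|[set xy : V * V | (dist xy.1 xy.2 == k) &&
      [exists p : k.-tuple V, is_geodesic xy.1 p xy.2 &&
         (onth (walk_edges xy.1 p) t.-1 == Some e)]]|.

End Digraph.

Record kautz (d D : nat) := Kautz {
  kword :> D.-tuple 'I_d.+1;
  _ : adjacent_distinct kword
}.

HB.instance Definition _ (d D : nat) := [isSub for @kword d D].
HB.instance Definition _ (d D : nat) := [Finite of kautz d D by <:].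

Section Kautz.
Variables d D : nat.
Implicit Types (u v : kautz d D) (e : kautz d D * kautz d D).

Definition kautz_edge : rel (kautz d D) := fun u v =>
  [exists c : 'I_d.+1,
     adjacent_distinct (rcons u c) && (v == behead (rcons u c) :> seq _)].

(* For D >= 1 the last letter of the head of e is the letter a_D appended to
   its tail; the default ord0 is then irrelevant. *)
Definition edge_word e : seq 'I_d.+1 := rcons e.1 (last ord0 e.2).

Definition N e (k t : nat) : nat := geodesic_count kautz_edge e k t.

Definition U e (k : nat) : nat := \sum_(1 <= t < k.+1) N e k t.

Definition cong e : nat := \sum_(1 <= k < D.+1) U e k.

Definition ternary (w : seq 'I_d.+1) : bool := all (fun a : 'I_d.+1 => a < 3) w.

(* For D = 1 the truncated exponent D - 2 is multiplied by D - 1 = 0. *)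
Definition tau : nat := (D - 1) * d ^ (D - 2) + D * d ^ (D - 1).

End Kautz.

Definition Cconst (d : nat) : rat := (8 / (d%:R - 1))%R.

(* Main.v *)
(* Write the edge word w = a_0 ... a_D as cut after p letters, with q = D + 1 - p
letters to the right of the cut. The pairs (x, y) such that x ++ y contains w
with the cut at the junction of x and y number d^(D-1), and e is then an edge of
a walk of length D from x to y. This walk is the geodesic unless, for some l, the
last l letters of x are the first l letters of y. Such an overlap makes l a
period of a factor of w around the cut: for l <= min(p, q) this factor is a
square, for l > max(p, q) it yields a border of w, and otherwise 7/4+ freeness
forces l - m >= m / 3, where m = min(p, q). Moreover l and l + 1 cannot both
occur, as this would make two adjacent letters of w equal. An overlap of length l
prescribes l - m further letters, so the cut loses at most
d^(D-1) d^(-ceil(m/3)) / (1 - d^(-2)) pairs; every m occurs for at most two cuts,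
and summing over m gives at most 8 d^(D-1) / (d-1).

For the congestion, deleting the first or the last edge of a geodesic gives
k U_(k+1) <= d (k+1) U_k, hence U_(D-j) >= (1 - j/D) d^(-j) U_D; the terms j >= D
of the series of (1 - j/D) d^(-j) being nonpositive, the sum over j < D is at
least the full series d/(d-1) (1 - 1/(D(d-1))). *)

Require Import Defs.
From mathcomp Require Import all_boot all_order all_algebra.
From mathcomp Require Import zify ring lra.
Import Order.TTheory GRing.Theory Num.Theory.
Set Implicit Arguments.
Unset Strict Implicit.
Unset Printing Implicit Defensive.

(** * Geodesics in digraphs *)

Section DigraphFacts.
Variables (V : finType) (r : rel V).
Implicit Types (x y v : V) (p : seq V) (e : V * V).

Lemma dist_le_walk x p y : is_walk r x p y -> dist r x y <= size p.
Proof.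
move=> wp; rewrite /dist; set P := fun n => _.
have [ltpV|leVp] := ltnP (size p) #|V|; last first.
  (* A walk with at least [#|V|] edges is covered too, because a failed search in [dist] returns
     [#|V|]. *)
  by apply: leq_trans leVp; rewrite -[leqRHS](size_iota 0) find_size.
rewrite leqNgt; apply/negP => /(before_find 0).
rewrite nth_iota // add0n /P.
by move/negbT/existsPn/(_ (in_tuple p)); rewrite wp.
Qed.

Lemma distE x p y : is_walk r x p y ->
  (forall q, is_walk r x q y -> size p <= size q) -> dist r x y = size p.
Proof.
move=> wp min_p; apply/eqP; rewrite eqn_leq dist_le_walk //=.
(* Removing cycles leaves a walk with distinct vertices, so the minimal length lies within the
   search range of [dist]. *)
have ltpV : size p < #|V|.
  have [path_p /eqP last_p] := andP wp.
  case/shortenP: path_p last_p => p' path_p' uniq_p' _ last_p'.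
  apply: (@leq_ltn_trans (size p')).
    by apply: min_p; rewrite /is_walk path_p' last_p' eqxx.
  have -> : (size p').+1 = #|x :: p'| by rewrite (card_uniqP uniq_p').
  exact: max_card.
rewrite /dist; set P := fun n => _; set s := iota _ _.
have [hasP|] := boolP (has P s); last first.
  by move/hasNfind=> ->; rewrite size_iota; exact: ltnW.
have := nth_find 0 hasP; rewrite /P => /existsP[q /min_p].
rewrite -/P size_tuple nth_iota // -[ltnRHS](size_iota 0) -has_find //.
Qed.

(** A shorter walk to the penultimate vertex, prolonged by the last edge, would beat the
    geodesic. *)
Lemma geodesic_rcons x p y : is_geodesic r x (rcons p y) y ->
  is_geodesic r x p (last x p) && r (last x p) y.
Proof.
rewrite /is_geodesic /is_walk rcons_path last_rcons size_rcons.
case/andP=> /andP[/andP[path_p last_r] _] /eqP szp.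
rewrite path_p last_r eqxx andbT /=; apply/eqP/esym/distE => [|q].
  by rewrite /is_walk path_p eqxx.
case/andP=> path_q /eqP last_q; rewrite -ltnS szp -(size_rcons q y).
by apply: dist_le_walk; rewrite /is_walk rcons_path last_rcons path_q last_q last_r eqxx.
Qed.

Lemma geodesic_cons x v p y : is_geodesic r x (v :: p) y ->
  is_geodesic r v p y && r x v.
Proof.
rewrite /is_geodesic /is_walk /=.
case/andP=> /andP[/andP[r_xv path_p] last_p] /eqP szp.
rewrite r_xv path_p last_p andbT /=; apply/eqP/esym/distE => [|q].
  by rewrite /is_walk path_p.
case/andP=> path_q last_q; rewrite -ltnS szp -[leqRHS]/(size (v :: q)).
by apply: dist_le_walk; rewrite /is_walk /= r_xv path_q.
Qed.

Lemma nth_walk_edges e x p i : i < size p ->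
  nth e (walk_edges x p) i = (nth e.1 (x :: p) i, nth e.2 p i).
Proof.
rewrite /walk_edges; case: e => a b; elim: p x i => [//|v p IH] x [//|i] lti /=.
exact: IH.
Qed.

Lemma size_walk_edges x p : size (walk_edges x p) = size p.
Proof. by rewrite size_zip; apply/minn_idPr. Qed.

(** * Geodesics with a given edge at a given position *)

Definition geodesic_pairs e k t : {set V * V} :=
  [set xy : V * V | (dist r xy.1 xy.2 == k) &&
      [exists p : k.-tuple V, is_geodesic r xy.1 p xy.2 &&
         (onth (walk_edges xy.1 p) t.-1 == Some e)]].

Lemma geodesic_pairsP e k t x y :
  reflect (exists2 p : seq V, size p = k &
             is_geodesic r x p y /\ onth (walk_edges x p) t.-1 = Some e)
          ((x, y) \in geodesic_pairs e k t).
Proof.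
apply: (iffP idP) => [|[p szp [geo_p e_p]]].
  rewrite inE => /andP[_ /existsP[p /andP[geo_p /eqP e_p]]].
  by exists p; rewrite ?size_tuple.
rewrite inE /=; have [_ /eqP <-] := andP geo_p; rewrite szp eqxx /=.
by apply/existsP; exists (tcast szp (in_tuple p)); rewrite val_tcast geo_p e_p /=.
Qed.

Lemma walk_edges_rcons x p y :
  walk_edges x (rcons p y) = rcons (walk_edges x p) (last x p, y).
Proof. by rewrite /walk_edges; elim: p x => [|v p IH] x //=; rewrite IH. Qed.

Lemma geodesic_pairs_rcons e k t x y : 0 < t <= k ->
  (x, y) \in geodesic_pairs e k.+1 t ->
  exists2 v, (x, v) \in geodesic_pairs e k t & r v y.
Proof.
case/andP=> t_gt0 le_tk /geodesic_pairsP[p]; case/lastP: p => [//|p y'].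
rewrite size_rcons => -[szp] [geo_p].
have eqy : y' = y by case/andP: geo_p => /andP[_]; rewrite last_rcons => /eqP.
move: geo_p; rewrite {}eqy => /geodesic_rcons /andP[geo_p r_y].
rewrite walk_edges_rcons -cats1 onth_cat size_walk_edges szp ifT ?prednK // => e_p.
by exists (last x p) => //; apply/geodesic_pairsP; exists p.
Qed.

Lemma geodesic_pairs_cons e k t x y : 0 < t ->
  (x, y) \in geodesic_pairs e k.+1 t.+1 ->
  exists2 v, (v, y) \in geodesic_pairs e k t & r x v.
Proof.
case: t => // t _ /geodesic_pairsP[[//|v p]] /= [szp] [/geodesic_cons /andP[geo_p r_x]] e_p.
by exists v => //; apply/geodesic_pairsP; exists p.
Qed.

Lemma card_bigcup_leq (I T : finType) (B : {set I}) (F : I -> {set T}) d :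
  (forall i, #|F i| <= d) -> #|\bigcup_(i in B) F i| <= d * #|B|.
Proof.
move=> leF; rewrite mulnC -sum_nat_const.
elim/big_ind2: _ => [|A m C n leA leC|i _]; rewrite ?cards0 ?leF //.
exact: leq_trans (leq_card_setU _ _) (leq_add leA leC).
Qed.

Variable d : nat.

(** Deleting the last edge keeps [e] at position [t], and each shortened pair has at most [d]
    prolongations. *)
Lemma geodesic_count_rcons e k t : (forall v, #|[set y | r v y]| <= d) ->
  0 < t <= k -> geodesic_count r e k.+1 t <= d * geodesic_count r e k t.
Proof.
move=> outdeg tk; rewrite /geodesic_count -!/(geodesic_pairs _ _ _).
set A := geodesic_pairs _ _ _; set B := geodesic_pairs _ _ _.
have sub : A \subset \bigcup_(xv in B) setX [set xv.1] [set y | r xv.2 y].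
  apply/subsetP => -[x y] /(geodesic_pairs_rcons tk)[v xv_B r_vy].
  by apply/bigcupP; exists (x, v); rewrite // !inE /= eqxx.
apply: leq_trans (subset_leq_card sub) (card_bigcup_leq _ _) => xv.
by rewrite cardsX cards1 mul1n outdeg.
Qed.

Lemma geodesic_count_cons e k t : (forall v, #|[set x | r x v]| <= d) ->
  0 < t -> geodesic_count r e k.+1 t.+1 <= d * geodesic_count r e k t.
Proof.
move=> indeg t_gt0; rewrite /geodesic_count -!/(geodesic_pairs _ _ _).
set A := geodesic_pairs _ _ _; set B := geodesic_pairs _ _ _.
have sub : A \subset \bigcup_(vy in B) setX [set x | r x vy.1] [set vy.2].
  apply/subsetP => -[x y] /(geodesic_pairs_cons t_gt0)[v vy_B r_xv].
  by apply/bigcupP; exists (v, y); rewrite // !inE /= r_xv eqxx.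
apply: leq_trans (subset_leq_card sub) (card_bigcup_leq _ _) => xv.
by rewrite cardsX cards1 muln1 indeg.
Qed.

(* The weights (k - i) / k and i / k on deleting the last, respectively the
   first, edge make every position of e contribute equally. *)
Lemma sum_geodesic_count_succ_leq e k :
  (forall v, #|[set y | r v y]| <= d) -> (forall v, #|[set x | r x v]| <= d) ->
  k * (\sum_(1 <= t < k.+2) geodesic_count r e k.+1 t) <=
    d * k.+1 * \sum_(1 <= t < k.+1) geodesic_count r e k t.
Proof.
move=> outdeg indeg; rewrite !big_add1 /=.
set a := fun t => geodesic_count r e k.+1 t.+1.
set b := fun t => geodesic_count r e k t.+1.
have -> : k * (\sum_(0 <= i < k.+1) a i) =
    \sum_(0 <= i < k.+1) (k - i) * a i + \sum_(0 <= i < k.+1) i * a i.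
  rewrite -big_split big_distrr /= big_nat [RHS]big_nat.
  by apply: eq_bigr => i lei; rewrite -mulnDl subnK.
(* The terms of weight zero, last in one sum and first in the other, drop out. After the shift,
   [b i] bounds both remaining terms of index [i], with total weight [(k - i) + i.+1 = k.+1]. *)
rewrite big_nat_recr //= subnn mul0n addn0 big_nat_recl // mul0n add0n.
rewrite -big_split big_distrr /= big_nat [leqRHS]big_nat.
apply: leq_sum => i /= ltik.
have le1 : a i <= d * b i by exact: geodesic_count_rcons.
have le2 : a i.+1 <= d * b i by exact: geodesic_count_cons.
apply: leq_trans (leq_add (leq_mul (leqnn _) le1) (leq_mul (leqnn _) le2)) _.
by rewrite -mulnDl addnS subnK ?(ltnW ltik) // mulnCA -[leqRHS]mulnA.
Qed.

End DigraphFacts.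

(** * Words and walks in Kautz digraphs *)

Section KautzCounting.
Variables d D : nat.
Implicit Types (u v x y : kautz d D) (s w : seq 'I_d.+1).

Lemma size_kautz x : size x = D.
Proof. exact: size_tuple. Qed.

Lemma kautz_adjacent x : adjacent_distinct x.
Proof. by case: x. Qed.

Lemma kautz_ex s : size s = D -> adjacent_distinct s -> exists x, x = s :> seq _.
Proof.
move=> /eqP szs adj_s; have adj_t : adjacent_distinct (Tuple szs) by [].
by exists (Kautz adj_t).
Qed.

Lemma kautz_inj x y : x = y :> seq _ -> x = y.
Proof. by move=> eq_xy; apply/val_inj/val_inj. Qed.

Lemma adjacent_distinct_cat s1 s2 : s1 != [::] -> s2 != [::] ->
  adjacent_distinct (s1 ++ s2) =
    [&& adjacent_distinct s1, adjacent_distinct s2 & last ord0 s1 != head ord0 s2].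
Proof.
case: s1 s2 => [//|a s1] [//|b s2] _ _.
by rewrite /adjacent_distinct /= cat_path /= [X in _ && X]andbC.
Qed.

Lemma adjacent_distinct_rcons s c : s != [::] ->
  adjacent_distinct (rcons s c) = adjacent_distinct s && (c != last ord0 s).
Proof. by move=> sN0; rewrite -cats1 adjacent_distinct_cat //= eq_sym. Qed.

Lemma adjacent_distinct_rev s : adjacent_distinct (rev s) = adjacent_distinct s.
Proof. by rewrite /adjacent_distinct rev_sorted; apply: eq_sorted => a b; rewrite eq_sym. Qed.

(** Induction on the number of free letters: as [s] is nonempty, the next letter avoids exactly one
    of [d.+1] values. *)
Lemma card_kautz_prefix s : 0 < size s <= D -> adjacent_distinct s ->
  #|[set x : kautz d D | prefix s x]| = d ^ (D - size s).
Proof.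
case/andP; have [n] := ubnP (D - size s); elim: n s => // n IH s le_n s_gt0.
rewrite leq_eqVlt => /orP[/eqP szs|ltsD] adj_s.
  have [x xs] := kautz_ex szs adj_s; rewrite szs subnn expn0.
  rewrite -(cards1 x); apply: eq_card => y; rewrite !inE prefixE szs.
  rewrite take_oversize ?size_kautz // -xs.
  by apply/eqP/eqP => [/kautz_inj|->].
have sN0 : s != [::] by rewrite -size_eq0 -lt0n.
have prefix_nth y c : prefix (rcons s c) y = prefix s y && (nth ord0 y (size s) == c).
  by rewrite !prefixE size_rcons (take_nth ord0) ?size_kautz // eqseq_rcons.
pose next y := nth ord0 y (size s).
rewrite -sum1_card (partition_big next (predC1 (last ord0 s))) /=; last first.
  move=> y; rewrite inE => s_y.
  have : prefix (rcons s (next y)) y by rewrite prefix_nth s_y eqxx.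
  rewrite prefixE => /eqP eq_take; have := take_sorted (size s).+1 (kautz_adjacent y).
  rewrite -(size_rcons s (next y)) eq_take -/(adjacent_distinct _).
  by rewrite adjacent_distinct_rcons // => /andP[].
have -> : D - size s = (D - (size s).+1).+1 by lia.
rewrite expnS -[X in X * _](_ : #|predC1 (last ord0 s)| = d); last first.
  by rewrite cardC1 card_ord.
rewrite -sum_nat_const; apply: eq_bigr => c c_last.
rewrite -(size_rcons s c) -IH ?size_rcons //; last 2 first.
- by lia.
- by rewrite adjacent_distinct_rcons ?adj_s.
rewrite sum1dep_card; apply: eq_card => y.
by rewrite !inE prefix_nth.
Qed.

Lemma card_kautz_prefix_leq s : 0 < size s <= D ->
  #|[set x : kautz d D | prefix s x]| <= d ^ (D - size s).
Proof.
move=> szs; have [adj_s|adj_s] := boolP (adjacent_distinct s).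
  by rewrite card_kautz_prefix.
rewrite (_ : finset _ = set0) ?cards0 //; apply/setP => x; rewrite !inE.
apply: contraNF adj_s; rewrite prefixE => /eqP <-.
exact/take_sorted/kautz_adjacent.
Qed.

(** Reversal of words is an involution on the vertices. *)
Lemma card_kautz_suffix s :
  #|[set x : kautz d D | suffix s x]| = #|[set x : kautz d D | prefix (rev s) x]|.
Proof.
have adj_rev x : adjacent_distinct [tuple of rev x].
  by rewrite adjacent_distinct_rev kautz_adjacent.
pose f x := Kautz (adj_rev x).
have fK : involutive f by move=> x; apply: kautz_inj; rewrite /= revK.
rewrite -[RHS](on_card_preimset (f := f)); last exact/onW_bij/inv_bij.
by apply: eq_card => x; rewrite !inE.
Qed.

(** * Edges, degrees and walks of the Kautz digraph *)

Hypothesis D_gt0 : 0 < D.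

Lemma kautz_edgeE u v : kautz_edge u v ->
  edge_word (u, v) = head ord0 u :: v /\ adjacent_distinct (edge_word (u, v)).
Proof.
case/existsP=> c /andP[adj_uc /eqP def_v]; rewrite /edge_word /= def_v.
have : u != [::] :> seq _ by rewrite -size_eq0 size_kautz -lt0n.
by case: (u : seq _) adj_uc {def_v} => [//|a s] /=; rewrite last_rcons.
Qed.

Lemma kautz_edge_behead u v : kautz_edge u v -> behead u = take D.-1 v.
Proof.
case/kautz_edgeE => + _; rewrite /edge_word /=.
have : u != [::] :> seq _ by rewrite -size_eq0 size_kautz -lt0n.
have := size_kautz u; case: (u : seq _) => [//|a s] /= szs _ [<-].
by have -> : D.-1 = size s; [rewrite -szs | rewrite -cats1 take_size_cat].
Qed.

Lemma kautz_outdeg u : #|[set v | kautz_edge u v]| <= d.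
Proof.
rewrite -[leqRHS](_ : #|predC1 (last ord0 u)| = d); last by rewrite cardC1 card_ord.
have uN0 : u != [::] :> seq _ by rewrite -size_eq0 size_kautz -lt0n.
rewrite -(card_in_imset (f := fun v : kautz d D => last ord0 v)).
  apply/subset_leq_card/subsetP => _ /imsetP[v + ->]; rewrite inE => /kautz_edgeE[_].
  by rewrite /edge_word adjacent_distinct_rcons //= => /andP[].
move=> v v'; rewrite !inE => /kautz_edgeE[def_v _] /kautz_edgeE[def_v' _] eq_last.
by apply: kautz_inj; move: def_v def_v'; rewrite /edge_word /= eq_last => -> [].
Qed.

Lemma kautz_indeg v : #|[set u | kautz_edge u v]| <= d.
Proof.
rewrite -[leqRHS](_ : #|predC1 (head ord0 v)| = d); last by rewrite cardC1 card_ord.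
have vN0 : v != [::] :> seq _ by rewrite -size_eq0 size_kautz -lt0n.
rewrite -(card_in_imset (f := fun u : kautz d D => head ord0 u)).
  apply/subset_leq_card/subsetP => _ /imsetP[u + ->]; rewrite inE => /kautz_edgeE[->].
  by rewrite -cat1s adjacent_distinct_cat //= => /andP[].
move=> u u'; rewrite !inE => /kautz_edgeE[def_u _] /kautz_edgeE[def_u' _] eq_head.
apply: kautz_inj; move: def_u def_u'; rewrite /edge_word /= eq_head => <-.
by move/rcons_inj=> [].
Qed.

(** Each edge shifts the word by one letter. Hence a walk with fewer than [D] edges forces a
    nonempty overlap of the end of [x] with the start of [y]. *)
Lemma kautz_walk_overlap x p y : is_walk (@kautz_edge d D) x p y -> size p <= D ->
  drop (size p) x = take (D - size p) y.
Proof.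
elim: p x => [|v p IH] x; rewrite /is_walk /=.
  by move=> /eqP -> _; rewrite drop0 subn0 take_oversize ?size_kautz.
case/andP=> /andP[x_v path_p last_p] szp.
have := IH v; rewrite /is_walk path_p last_p => /(_ isT (ltnW szp)) eq_v.
rewrite -{1}[(size p).+1]addn1 -drop_drop drop1 (kautz_edge_behead x_v).
have -> : D.-1 = (D - (size p).+1) + size p by move: (size p) szp => n; lia.
rewrite -take_drop eq_v take_takel //; exact: leq_sub2l.
Qed.

(** The vertices of the walk are the windows of width [D] sliding along [x ++ s]. *)
Lemma kautz_walk_ex x s : adjacent_distinct (x ++ s) ->
  exists2 p, path (@kautz_edge d D) x p & size p = size s /\
    forall i, i <= size s -> nth x (x :: p) i = take D (drop i (x ++ s)) :> seq _.
Proof.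
elim: s x => [|c s IH] x adj_xs.
  exists [::] => //; split=> // -[|//] _.
  by rewrite drop0 cats0 take_oversize ?size_kautz.
have xN0 : x != [::] :> seq _ by rewrite -size_eq0 size_kautz -lt0n.
have eq_xs : x ++ c :: s = head ord0 x :: behead (rcons x c) ++ s.
  by rewrite -cat_rcons; case: (x : seq _) xN0.
move: (adj_xs); rewrite eq_xs /= => adj_vs.
have adj_xc : adjacent_distinct (rcons x c).
  move: adj_xs; rewrite -cat_rcons /adjacent_distinct.
  by move/(take_sorted (size (rcons x c))); rewrite take_size_cat.
have [v def_v] : exists v, v = behead (rcons x c) :> seq _.
  apply: kautz_ex; first by rewrite size_behead size_rcons size_kautz.
  by case: (rcons x c) adj_xc => //= a s'; apply: path_sorted.
have [|p path_p [szp nth_p]] := IH v; first by rewrite def_v; apply: path_sorted adj_vs.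
exists (v :: p).
  rewrite /= path_p andbT; apply/existsP; exists c.
  by rewrite adj_xc def_v eqxx.
split=> [|[_|i lei]]; first by rewrite /= szp.
  by rewrite drop0 -eq_xs take_size_cat ?size_kautz.
rewrite /= -def_v -nth_p //; congr (tval (kword _)).
by case: i lei => [|i] lei //=; apply: set_nth_default; rewrite szp.
Qed.
End KautzCounting.

(** * Periods around a cut of the edge word *)

Section Words.
Variables (T : eqType) (x0 : T).
Implicit Types (w : seq T).

(** The factor of length [l + n] starting at [a] has period [l]; since [n <= l], it is a power with
    the single full repetition [k = 1]. *)
Lemma plus_power_free_period alpha w a n l : plus_power_free alpha w ->
  0 < l -> n <= l -> a + n + l <= size w ->
  (forall i, a <= i < a + n -> nth x0 w i = nth x0 w (i + l)) ->
  ((l + n)%:R / l%:R <= alpha)%R.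
Proof.
move=> free l_gt0 le_nl le_w per.
pose x := take l (drop a w); pose y := take n (drop a w).
have szx : size x = l by rewrite size_takel // size_drop; lia.
have szy : size y = n by rewrite size_takel // size_drop; lia.
have x_n0 : x <> [::] by move=> x_nil; move: szx l_gt0; rewrite x_nil /= => <-.
have y_x : prefix y x by rewrite prefixE szy /x take_takel.
have := free x y 1 x_n0 isT y_x; rewrite /= cats0 size_cat szx szy; apply.
have -> : y = take n (drop l (drop a w)).
  apply: (@eq_from_nth _ x0) => [|i].
    by rewrite szy size_takel // !size_drop; lia.
  rewrite szy => ltin; rewrite !nth_take // !nth_drop per; last by lia.
  by congr nth; lia.
rewrite /x -takeD; apply/infixP.
by exists (take a w), (drop (l + n) (drop a w)); rewrite !cat_take_drop.
Qed.

(* A word u ++ v extending w to both sides, whose junction cuts w after p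
   letters, has a square of period l centred at the junction only if w
   satisfies this condition. *)
Definition central_period w p l :=
  forall i, p - l <= i < p -> i + l < size w -> nth x0 w i = nth x0 w (i + l).

Variables (w : seq T) (p : nat).
Hypotheses (p_range : 0 < p < size w) (free : plus_power_free (7%:R / 4%:R)%R w).

Lemma free_period a n l : 0 < l -> n <= l -> a + n + l <= size w ->
  (forall i, a <= i < a + n -> nth x0 w i = nth x0 w (i + l)) -> 4 * n <= 3 * l.
Proof.
move=> l_gt0 le_nl le_w per; have := plus_power_free_period free l_gt0 le_nl le_w per.
rewrite ler_pdivrMr ?ltr0n // mulrAC ler_pdivlMr ?ltr0n //.
by rewrite -!natrM ler_nat; lia.
Qed.

Local Notation m := (minn p (size w - p)).
Local Notation M := (maxn p (size w - p)).

Lemma central_period_range l : unbordered w -> 0 < l < size w ->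
  central_period w p l -> m < l <= M /\ 4 * m <= 3 * l.
Proof.
move=> unb l_range per; have [le_lm|lt_ml] := leqP l m.
  (* The square around the cut lies entirely in [w], so [n = l] is possible in [free_period]. *)
  suff: 4 * l <= 3 * l by lia.
  by apply: (@free_period (p - l)) => [||| i i_range]; try apply: per; lia.
have [le_lM|lt_Ml] := leqP l M; last first.
  (* The period now spans all of [w], which gives a border of length [size w - l]. *)
  case: (unb (size w - l)); first by lia.
  rewrite subKn; last by lia.
  apply: (@eq_from_nth _ x0) => [|i]; rewrite size_take_min ?size_drop; first by lia.
  move=> lti; rewrite nth_take ?nth_drop; last by lia.
  by rewrite per 1?addnC //; lia.
(* The repeated block of length [m] is the shorter side of the cut: a prefix of [w] if the left side
   is shorter, a suffix otherwise. *)
split=> //; have [le_p|lt_p] := leqP p (size w - p).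
  by apply: (@free_period 0) => [||| i i_range]; try apply: per; lia.
by apply: (@free_period (p - l)) => [||| i i_range]; try apply: per; lia.
Qed.

(** One letter is compared with two adjacent ones: the first letter of [w] with those at [l] and
    [l.+1], or the letter at [p] with those at [p - l.+1] and [p - l]. *)
Lemma central_period_sparse l : sorted (fun a b => a != b) w -> m < l < M ->
  central_period w p l -> ~ central_period w p l.+1.
Proof.
move=> adj l_range per per1.
have adjE i : i.+1 < size w -> nth x0 w i <> nth x0 w i.+1.
  by move=> lti; apply/eqP; apply: (sortedP x0 adj).
have [le_p|lt_p] := leqP p (size w - p).
  have ltl : l.+1 < size w by lia.
  have [le0 le1] : p - l <= 0 < p /\ p - l.+1 <= 0 < p by lia.
  by case: (adjE _ ltl); rewrite -[RHS](per1 0) // -[LHS](per 0) // ltnW.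
have [lt_w lt_w0] : (p - l.+1).+1 < size w /\ p < size w by lia.
have [le0 le1] : p - l <= p - l < p /\ p - l.+1 <= p - l.+1 < p by lia.
have [eq0 eq1] : p - l + l = p /\ p - l.+1 + l.+1 = p by lia.
case: (adjE _ lt_w); have -> : (p - l.+1).+1 = p - l by lia.
by rewrite (per1 _ le1) ?(per _ le0) ?eq0 ?eq1.
Qed.

End Words.

(** * Geodesics through an edge *)

Section CountingThroughAnEdge.
Variables (d D : nat) (D_gt0 : 0 < D) (e : kautz d D * kautz d D).
Hypothesis edge_e : kautz_edge e.1 e.2.
Local Notation w := (edge_word e).

Lemma size_edge_word : size w = D.+1.
Proof. by rewrite size_rcons size_kautz. Qed.

Lemma adjacent_edge_word : adjacent_distinct w.
Proof. by case: e edge_e => u v /(kautz_edgeE D_gt0)[]. Qed.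

Lemma take_edge_word : take D w = e.1.
Proof. by rewrite /edge_word -cats1 take_size_cat ?size_kautz. Qed.

Lemma behead_edge_word : behead w = e.2.
Proof. by case: e edge_e => u v /(kautz_edgeE D_gt0)[->]. Qed.

(* The pairs (x, y) for which x ++ y contains the edge word at position
   t - 1, so that the walk spelled by x ++ y has e as its t-th edge. *)
Definition through_pairs t : {set kautz d D * kautz d D} :=
  setX [set x : kautz d D | suffix (take (D.+1 - t) w) x]
       [set y : kautz d D | prefix (drop (D.+1 - t) w) y].

(** An overlap of length [l] is what a walk of length [D - l] would leave; [l = D] means [x = y]. *)
Definition bad_pairs t l : {set kautz d D * kautz d D} :=
  [set xy in through_pairs t | drop (D - l) xy.1 == take l xy.2 :> seq _].

Variable t : nat.
Hypothesis t_range : 0 < t <= D.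
Local Notation p := (D.+1 - t).

Lemma through_pairsP x y : (x, y) \in through_pairs t ->
  exists a b, [/\ x = a ++ take p w :> seq _, y = drop p w ++ b :> seq _,
                  size a = t.-1 & size b = D - t].
Proof.
rewrite !inE => /andP[/suffixP[a def_x] /prefixP[b def_y]]; exists a, b.
have := congr1 size def_x; have := congr1 size def_y.
rewrite !size_kautz !size_cat size_take_min size_drop size_edge_word => szb sza.
by move: (size a) (size b) sza szb => na nb sza szb; split=> //; lia.
Qed.

Lemma through_pairs_sub :
  through_pairs t \subset
    geodesic_pairs (@kautz_edge d D) e D t :|: \bigcup_(l < D) bad_pairs t l.+1.
Proof.
apply/subsetP => -[x y] xy_t; rewrite inE.
have [_|not_bad] := boolP ((x, y) \in \bigcup_(l < D) bad_pairs t l.+1); first by rewrite orbT.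
rewrite orbF; have [a [b [def_x def_y sza szb]]] := through_pairsP xy_t.
have def_xy : x ++ y = a ++ w ++ b by rewrite def_x def_y -!catA (catA (take p w)) cat_take_drop.
have xN0 : x != [::] :> seq _ by rewrite -size_eq0 size_kautz -lt0n.
have yN0 : y != [::] :> seq _ by rewrite -size_eq0 size_kautz -lt0n.
(* The two letters at the junction are adjacent letters of the edge word. *)
have adj_xy : adjacent_distinct (x ++ y).
  rewrite adjacent_distinct_cat // !kautz_adjacent /=.
  have := adjacent_edge_word; rewrite -{1}(cat_take_drop p w).
  have t1N0 : take p w != [::] by rewrite -size_eq0 size_take_min size_edge_word; lia.
  have t2N0 : drop p w != [::] by rewrite -size_eq0 size_drop size_edge_word; lia.
  rewrite adjacent_distinct_cat // => /and3P[_ _].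
  rewrite def_x def_y last_cat; case: (take p w) t1N0 => //= c s _.
  by case: (drop p w) t2N0.
have [q path_q [szq nth_q]] := kautz_walk_ex D_gt0 adj_xy.
rewrite size_kautz in szq nth_q.
have walk_q : is_walk (@kautz_edge d D) x q y.
  rewrite /is_walk path_q (last_nth x); have := nth_q _ (eq_leq szq).
  rewrite drop_size_cat ?size_kautz ?szq // take_oversize ?size_kautz //.
  by move/kautz_inj => ->; rewrite eqxx.
have dist_xy : dist (@kautz_edge d D) x y = size q.
  apply: distE => // q' walk_q'; rewrite leqNgt szq; apply: contraNN not_bad => lt_q'.
  (* The overlap has length [D - size q']; the union is indexed by its predecessor. *)
  have lt_l : (D - size q').-1 < D by lia.
  apply/bigcupP; exists (Ordinal lt_l) => //.
  rewrite inE xy_t /= prednK ?subn_gt0 // subKn ?(ltnW lt_q') //.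
  by rewrite (kautz_walk_overlap D_gt0 walk_q') // ltnW.
apply/geodesic_pairsP; exists q => //; split.
  by rewrite /is_geodesic walk_q dist_xy eqxx.
have lt_tq : t.-1 < size q by rewrite szq; lia.
have drop_xy : drop t.-1 (x ++ y) = w ++ b by rewrite def_xy drop_size_cat.
rewrite onthE (nth_map e) ?size_walk_edges // nth_walk_edges //; congr Some.
rewrite [RHS]surjective_pairing; congr (_, _); apply: kautz_inj.
  rewrite (set_nth_default x) /=; last by apply: ltnW.
  rewrite nth_q; last by lia.
  by rewrite drop_xy takel_cat ?size_edge_word // take_edge_word.
rewrite (set_nth_default x) // -[nth x q _]/(nth x (x :: q) t.-1.+1) nth_q; last by lia.
rewrite -[t.-1.+1]add1n -drop_drop drop_xy drop1 -behead_edge_word.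
have : size w = D.+1 := size_edge_word.
by case: w => //= c s [<-]; rewrite take_size_cat.
Qed.

Lemma card_through_pairs : #|through_pairs t| = d ^ (D - 1).
Proof.
have adj_w := adjacent_edge_word.
rewrite cardsX card_kautz_suffix !card_kautz_prefix ?size_rev ?size_take_min ?size_drop ?size_edge_word.
- by rewrite -expnD; congr (_ ^ _); lia.
- by lia.
- exact: drop_sorted.
- by lia.
- by rewrite adjacent_distinct_rev; apply: take_sorted.
Qed.

Lemma N_lower_bound :
  d ^ (D - 1) <= N e D t + \sum_(l < D) #|bad_pairs t l.+1|.
Proof.
rewrite -card_through_pairs; apply: leq_trans (subset_leq_card through_pairs_sub) _.
apply: leq_trans (leq_card_setU _ _) _; rewrite leq_add2l.
elim/big_ind2: _ => [|A k B n leA leB|//]; first by rewrite cards0.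
exact: leq_trans (leq_card_setU _ _) (leq_add leA leB).
Qed.

Lemma bad_pairs_central_period l : 0 < l <= D -> bad_pairs t l != set0 ->
  central_period ord0 w p l.
Proof.
move=> l_range /set0Pn[[x y]]; rewrite inE /= => /andP[].
case/through_pairsP=> a [b [def_x def_y sza szb]] /eqP eq_xy i i_range lti.
rewrite size_edge_word in lti.
(* The overlap letter of index [i + l - p] is read in [x] as letter [i] of [w], and in [y] as letter
   [i + l]. *)
have -> : nth ord0 w i = nth ord0 (drop (D - l) x) (i + l - p).
  rewrite nth_drop def_x nth_cat sza ifF; last by lia.
  by rewrite nth_take; [congr nth|]; lia.
rewrite eq_xy nth_take; last by lia.
rewrite def_y nth_cat size_drop size_edge_word ifT; last by lia.
by rewrite nth_drop; congr nth; lia.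
Qed.

(** The overlap fits inside the longer part of [w]. That part stays fixed in its own vertex and
    dictates [l] letters of the other vertex, instead of [minn t p]. *)
Lemma card_bad_pairs_leq l : minn t p < l <= maxn t p ->
  #|bad_pairs t l| <= d ^ (D - 1 - (l - minn t p)).
Proof.
move=> l_range; have [le_lp|lt_pl] := leqP l p.
  pose Y := [set y : kautz d D | prefix (drop (p - l) (take p w)) y].
  apply: (@leq_trans #|setX [set x : kautz d D | suffix (take p w) x] Y|).
    apply/subset_leq_card/subsetP => -[x y]; rewrite inE => /andP[xy_t /eqP /= eq_xy].
    have [a [b [def_x _ sza _]]] := through_pairsP xy_t.
    have : (x, y) \in through_pairs t by []; rewrite !inE /= => /andP[-> _] /=.
    rewrite prefixE size_drop size_take_min size_edge_word (minn_idPl _) ?leq_subr //.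
    rewrite subKn // -eq_xy def_x drop_cat sza ifF; last by lia.
    by apply/eqP; congr drop; lia.
  rewrite cardsX card_kautz_suffix.
  apply: leq_trans (leq_mul (card_kautz_prefix_leq _) (card_kautz_prefix_leq _)) _.
  - by rewrite size_rev size_take_min size_edge_word; lia.
  - by rewrite size_drop size_take_min size_edge_word; lia.
  rewrite size_rev size_drop size_take_min size_edge_word -expnD.
  by rewrite eq_leq //; congr (_ ^ _); lia.
pose X := [set x : kautz d D | suffix (take l (drop p w)) x].
apply: (@leq_trans #|setX X [set y : kautz d D | prefix (drop p w) y]|).
  apply/subset_leq_card/subsetP => -[x y]; rewrite inE => /andP[xy_t /eqP /= eq_xy].
  have [a [b [_ def_y _ szb]]] := through_pairsP xy_t.
  have : (x, y) \in through_pairs t by []; rewrite !inE /= => /andP[_ ->]; rewrite andbT.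
  rewrite suffixE size_kautz size_take_min size_drop size_edge_word (minn_idPl _); last by lia.
  by rewrite eq_xy def_y takel_cat // size_drop size_edge_word; lia.
rewrite cardsX card_kautz_suffix.
apply: leq_trans (leq_mul (card_kautz_prefix_leq _) (card_kautz_prefix_leq _)) _.
- by rewrite size_rev size_take_min size_drop size_edge_word; lia.
- by rewrite size_drop size_edge_word; lia.
rewrite size_rev size_take_min size_drop size_edge_word -expnD.
by rewrite eq_leq //; congr (_ ^ _); lia.
Qed.

End CountingThroughAnEdge.

(** * Geometric sums *)

Section GeometricSums.
Local Open Scope ring_scope.
Variable R : realFieldType.
Implicit Types x : R.

(** At most one of the first two terms occurs and the rest is [x ^+ 2] times a sum of the same kind;
    the bound solves [S = 1 + x ^+ 2 * S]. *)
Lemma sparse_geometric_sum x n (P : pred nat) : 0 <= x -> x < 1 ->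
  (forall l, P l -> ~~ P l.+1) -> \sum_(l < n | P l) x ^+ l <= (1 - x ^+ 2)^-1.
Proof.
move=> x_ge0 x_lt1.
have x2_lt1 : x ^+ 2 < 1 by rewrite expr_lt1.
have x2_ge0 : 0 <= x ^+ 2 by rewrite exprn_ge0.
have ge1 : 1 <= (1 - x ^+ 2)^-1 by rewrite invf_ge1; lra.
have [k] := ubnP n; elim: k n P => // k IH [|[|n]] P ltn sparseP.
- by rewrite big_ord0; lra.
- by rewrite big_mkcond big_ord1 expr0; case: (P _); lra.
rewrite big_mkcond !big_ord_recl /= expr0 expr1.
have -> : \sum_(i < n) (if P i.+2 then x ^+ i.+2 else 0) =
    x ^+ 2 * \sum_(i < n | P i.+2) x ^+ i.
  by rewrite -big_mkcond /= big_distrr /=; apply: eq_bigr => i _; rewrite -exprD.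
have := IH n (fun i => P i.+2) ltac:(lia) (fun l => sparseP l.+2).
move=> /(ler_wpM2l x2_ge0) leS.
have eqK : (1 - x ^+ 2)^-1 = 1 + x ^+ 2 * (1 - x ^+ 2)^-1 by field; lra.
rewrite [leRHS]eqK addrA lerD //.
by have := sparseP 0%N; case: (P 0%N) (P 1%N) => -[] /= sparse01; try lra; have := sparse01 isT.
Qed.

Lemma sparse_geometric_sum_from x s n (P : pred nat) : 0 <= x -> x < 1 ->
  (forall l, P l -> ~~ P l.+1) -> (forall l, P l -> (s <= l)%N) ->
  \sum_(l < n | P l) x ^+ (l - s) <= (1 - x ^+ 2)^-1.
Proof.
move=> x_ge0 x_lt1; elim: s n P => [|s IH] n P sparseP geP.
  by under eq_bigr do rewrite subn0; apply: sparse_geometric_sum.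
case: n => [|n].
  have : x ^+ 2 < 1 by rewrite expr_lt1.
  by rewrite big_ord0 invr_ge0; lra.
rewrite big_mkcond big_ord_recl ifF; last by apply/negP => /geP.
rewrite /= add0r -big_mkcond /=; apply: (IH n (fun l => P l.+1)) => l; last exact: geP.
exact: sparseP.
Qed.

(** Every exponent occurs three times, so the sum is completed to [3 * n] terms, where it has a
    closed form. *)
Lemma sum_expr_div3 x n : 0 <= x -> x < 1 ->
  \sum_(i < n) x ^+ (i %/ 3).+1 <= 3 * x / (1 - x).
Proof.
move=> x_ge0 x_lt1; have sum3 k : \sum_(i < 3 * k) x ^+ (i %/ 3).+1 = 3 * x / (1 - x) * (1 - x ^+ k).
  elim: k => [|k IH]; first by rewrite muln0 big_ord0 expr0 subrr mulr0.
  rewrite mulnS addnC !addnS addn0 !big_ord_recr /= IH.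
  have -> : (3 * k %/ 3 = k)%N by lia.
  have -> : ((3 * k).+1 %/ 3 = k)%N by lia.
  have -> : ((3 * k).+2 %/ 3 = k)%N by lia.
  by rewrite exprS; field; rewrite subr_eq0 gt_eqF.
apply: (@le_trans _ _ (\sum_(i < 3 * n) x ^+ (i %/ 3).+1)).
  rewrite -!(big_mkord xpredT (fun i => x ^+ (i %/ 3).+1)) [leRHS](@big_cat_nat _ _ _ n) //=; last by lia.
  by rewrite lerDl sumr_ge0 // => i _; rewrite exprn_ge0.
have xn_ge0 : 0 <= x ^+ n by rewrite exprn_ge0.
by rewrite sum3 ler_piMr ?divr_ge0; lra.
Qed.

(** The closed form of the partial sums, taken at [n = D], exceeds the bound by
    [x ^+ D * (x / (1 - x) ^+ 2)]. *)
Lemma sum_arith_geometric_ge x D : 0 <= x -> x < 1 ->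
  D%:R / (1 - x) - x / (1 - x) ^+ 2 <= \sum_(j < D) (D - j)%:R * x ^+ j.
Proof.
move=> x_ge0 x_lt1; have sumE n : (n <= D)%N -> \sum_(j < n) (D - j)%:R * x ^+ j =
    D%:R / (1 - x) - x / (1 - x) ^+ 2
    - x ^+ n * ((D - n)%:R / (1 - x) - x / (1 - x) ^+ 2).
  elim: n => [|n IH] len; first by rewrite big_ord0 subn0 expr0; ring.
  rewrite big_ord_recr /= IH ?(ltnW len) // !natrB ?(ltnW len) // -natr1 (exprS x n).
  by field; rewrite subr_eq0 gt_eqF.
rewrite sumE // subnn mul0r sub0r mulrN opprK lerDl.
by rewrite mulr_ge0 ?exprn_ge0 ?divr_ge0 ?sqr_ge0.
Qed.

End GeometricSums.

(** * Bounds on the congestion *)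

Section CongestionBounds.
Local Open Scope ring_scope.
Variables (d D : nat) (e : kautz d D * kautz d D).
Hypotheses (d_ge2 : (2 <= d)%N) (D_gt0 : (0 < D)%N).
Let x : rat := d%:R^-1.

Lemma natr_d_ge2 : 2 <= d%:R :> rat.
Proof. by rewrite (ler_nat _ 2). Qed.

Lemma inv_d_range : 0 <= x < 1.
Proof.
rewrite invr_ge0 ler0n invf_lt1 ?ltr1n ?ltr0n //; exact: ltnW.
Qed.

Lemma expr_natr_subn n k : (k <= n)%N -> (d ^ (n - k))%:R = d%:R ^+ n * x ^+ k :> rat.
Proof.
move=> lekn; have d_neq0 : d%:R != 0 :> rat by rewrite pnatr_eq0; lia.
by rewrite natrX -[n in RHS](subnK lekn) exprD exprVn mulfK // expf_neq0.
Qed.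

Lemma U_succ_leq k : (0 < k)%N -> k%:R * (U e k.+1)%:R <= d%:R * k.+1%:R * (U e k)%:R :> rat.
Proof.
move=> k_gt0; rewrite -!natrM ler_nat.
apply: sum_geodesic_count_succ_leq => v; [exact: kautz_outdeg | exact: kautz_indeg].
Qed.

Lemma U_ge j : (j < D)%N -> (D - j)%:R * x ^+ j * (U e D)%:R <= D%:R * (U e (D - j))%:R.
Proof.
have d_gt0 : 0 < d%:R :> rat by rewrite ltr0n; lia.
elim: j => [|j IH] ltj; first by rewrite subn0 expr0 mulr1.
have := IH (ltnW ltj); have := @U_succ_leq (D - j.+1) ltac:(lia).
have -> : ((D - j.+1).+1 = D - j)%N by lia.
set k := (D - j.+1)%N; set u := (U e D)%:R; set a := (U e (D - j))%:R; set b := (U e k)%:R.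
move=> le1 le2.
have n_gt0 : 0 < (D - j)%:R :> rat by rewrite ltr0n; lia.
(* Multiplying by [d * (D - j)] lets the two inequalities chain without division. *)
rewrite -(ler_pM2l (mulr_gt0 d_gt0 n_gt0)).
have -> : d%:R * (D - j)%:R * (k%:R * x ^+ j.+1 * u) = k%:R * ((D - j)%:R * x ^+ j * u).
  by rewrite exprS /x; field; rewrite gt_eqF.
apply: (@le_trans _ _ (k%:R * (D%:R * a))); first by rewrite ler_wpM2l.
rewrite mulrCA [leRHS]mulrCA ler_wpM2l //.
Qed.

Lemma cong_ge : d%:R / (d%:R - 1) * (1 - 1 / (D%:R * (d%:R - 1))) * (U e D)%:R
  <= (cong e)%:R :> rat.
Proof.
have [x_ge0 x_lt1] := andP inv_d_range; have d_ge := natr_d_ge2.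
have D_gt0r : 0 < D%:R :> rat by rewrite ltr0n.
rewrite -(ler_pM2l D_gt0r).
have -> : D%:R * (cong e)%:R = \sum_(j < D) D%:R * (U e (D - j))%:R :> rat.
  rewrite -big_distrr /= -natr_sum /cong big_nat_rev big_add1 /= big_mkord.
  by congr (_ * _%:R); apply: eq_bigr => j _; congr (U e _); lia.
apply: le_trans (ler_sum _ (fun j _ => U_ge (ltn_ord j))).
rewrite -big_distrl /= mulrA ler_wpM2r //.
apply: le_trans (sum_arith_geometric_ge D x_ge0 x_lt1).
rewrite le_eqVlt; apply/orP; left; apply/eqP; rewrite /x.
by field; rewrite !gt_eqF //; lra.
Qed.

(** * Total loss to overlaps and the bound on [U e D] *)

Hypotheses (edge_e : kautz_edge e.1 e.2) (unb : unbordered (edge_word e)).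
Hypothesis free : plus_power_free (7 / 4) (edge_word e).

Lemma bad_pairs_sum i : (i < D)%N ->
  \sum_(l < D) #|bad_pairs e i.+1 l.+1|%:R <=
    d%:R ^+ (D - 1) * (1 - x ^+ 2)^-1 * (x ^+ (i %/ 3).+1 + x ^+ ((D - i.+1) %/ 3).+1).
Proof.
move=> ltiD; have [x_ge0 x_lt1] := andP inv_d_range.
have szw : size (edge_word e) = D.+1 by exact: size_edge_word.
pose p := (D.+1 - i.+1)%N; pose m := minn i.+1 p.
have def_q : (size (edge_word e) - p = i.+1)%N by rewrite szw /p; lia.
have p_range : (0 < p < size (edge_word e))%N by rewrite szw /p; lia.
pose P l := (l < D)%N && (bad_pairs e i.+1 l.+1 != set0).
have periodP l : P l -> [/\ central_period ord0 (edge_word e) p l.+1,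
    (m < l.+1 <= maxn i.+1 p)%N & (4 * m <= 3 * l.+1)%N].
  case/andP=> ltl bad_l; have per : central_period ord0 (edge_word e) p l.+1.
    by apply: bad_pairs_central_period => //; lia.
  have [] := central_period_range p_range free unb _ per; first by rewrite szw; lia.
  by rewrite def_q minnC maxnC.
have sparseP l : P l -> ~~ P l.+1.
  move=> /periodP[per /andP[lt_ml _] _]; apply/negP => /periodP[per1 /andP[_ le_lM] _].
  have := central_period_sparse p_range (adjacent_edge_word D_gt0 edge_e) _ per; apply => //.
  by rewrite def_q minnC maxnC -/m lt_ml.
(* Since [m] is positive, [r] is [m / 3] rounded up, and [4 * m <= 3 * l.+1] becomes
   [m + r <= l.+1]. *)
pose r := ((m - 1) %/ 3).+1.
have geP l : P l -> (m + r - 1 <= l)%N by case/periodP=> _ _; rewrite /r; lia.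
apply: (@le_trans _ _ (d%:R ^+ (D - 1) * x ^+ r * \sum_(l < D | P l) x ^+ (l - (m + r - 1)))).
  rewrite big_distrr /= [leRHS]big_mkcond /=; apply: ler_sum => l _.
  case: ifP => [Pl|]; last first.
    by rewrite /P ltn_ord /= => /negbFE/eqP ->; rewrite cards0.
  have [_ range_l _] := periodP l Pl; have ge_l := geP l Pl.
  rewrite -mulrA -exprD -expr_natr_subn; last by have := ltn_ord l; lia.
  rewrite ler_nat; have -> : (r + (l - (m + r - 1)) = l.+1 - m)%N by rewrite /r in ge_l *; lia.
  by apply: card_bad_pairs_leq => //; lia.
rewrite -[leRHS]mulrA [X in _ <= _ * X]mulrC mulrA ler_pM //.
- by rewrite mulr_ge0 ?exprn_ge0.
- by apply: sumr_ge0 => l _; rewrite exprn_ge0.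
- rewrite ler_wpM2l ?exprn_ge0 //.
  (* As [m] is [i.+1] or [D - i], the power [x ^+ r] is one of the two summands; keeping both makes
     the bound symmetric in the cut. *)
  have [xi_ge0 xj_ge0] := (exprn_ge0 (i %/ 3).+1 x_ge0, exprn_ge0 ((D - i.+1) %/ 3).+1 x_ge0).
  have [le_ip|lt_pi] := leqP i.+1 p.
    have -> : r = (i %/ 3).+1 by rewrite /r /m (minn_idPl le_ip) subn1.
    by rewrite lerDl.
  have -> : r = ((D - i.+1) %/ 3).+1 by rewrite /r /m (minn_idPr (ltnW lt_pi)) /p; congr (_ %/ _).+1; lia.
  by rewrite lerDr.
exact: sparse_geometric_sum_from.
Qed.

Lemma bad_pairs_total :
  \sum_(i < D) \sum_(l < D) #|bad_pairs e i.+1 l.+1|%:R <= Cconst d * d%:R ^+ (D - 1).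
Proof.
have [x_ge0 x_lt1] := andP inv_d_range; have d_ge := natr_d_ge2.
pose K := d%:R ^+ (D - 1) * (1 - x ^+ 2)^-1.
pose a (i : 'I_D) := x ^+ (i %/ 3).+1.
have K_ge0 : 0 <= K.
  by rewrite mulr_ge0 ?exprn_ge0 // invr_ge0 subr_ge0 expr_le1 // ltW.
apply: (@le_trans _ _ (\sum_(i < D) K * (a i + a (rev_ord i)))).
  by apply: ler_sum => i _; apply: bad_pairs_sum.
have sum_rev : \sum_i a (rev_ord i) = \sum_i a i by rewrite [RHS](reindex_inj rev_ord_inj).
rewrite -big_distrr big_split /= sum_rev.
have le_a : \sum_i a i <= 3 / (d%:R - 1).
  have -> : 3 / (d%:R - 1) = 3 * x / (1 - x).
    by rewrite /x; field; rewrite !gt_eqF //; lra.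
  exact: sum_expr_div3.
have x_le : x <= 1 / 2 by rewrite div1r lef_pV2 ?posrE //; lra.
have inv_le : (1 - x ^+ 2)^-1 <= 4 / 3.
  by rewrite -[leRHS]invf_div lef_pV2 ?posrE ?divr_gt0 //; nra.
have inv_ge0 : 0 <= (1 - x ^+ 2)^-1 by rewrite invr_ge0; nra.
have d1_ge0 : 0 <= (d%:R - 1)^-1 :> rat by rewrite invr_ge0; lra.
rewrite /K -mulrA [leRHS]mulrC ler_wpM2l ?exprn_ge0 //.
(* The constant 8 is [4 / 3 * (3 + 3)], where [4 / 3] is the value of [(1 - x ^+ 2)^-1] at
   [d = 2]. *)
apply: (@le_trans _ _ (4 / 3 * (3 / (d%:R - 1) + 3 / (d%:R - 1)))).
  by apply: ler_pM => //; [apply: addr_ge0; apply: sumr_ge0 => i _; apply: exprn_ge0 | apply: lerD].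
by rewrite /Cconst; lra.
Qed.

Lemma U_lower_bound : (D%:R - Cconst d) * d%:R ^+ (D - 1) <= (U e D)%:R.
Proof.
have le_N (i : 'I_D) : d%:R ^+ (D - 1) <= 
    (N e D i.+1)%:R + \sum_(l < D) #|bad_pairs e i.+1 l.+1|%:R :> rat.
  by rewrite -natrX -natr_sum -natrD ler_nat; apply: N_lower_bound => //=.
have := bad_pairs_total; have : \sum_(i < D) d%:R ^+ (D - 1) <= _ := ler_sum _ (fun i _ => le_N i).
rewrite big_split /= sumr_const card_ord -natr_sum mulrBl -mulr_natl.
rewrite /U big_add1 /= big_mkord; lra.
Qed.

End CongestionBounds.

(** * Comparison with [tau] *)

Local Open Scope ring_scope.

(** Here [y] is [d], [z] is [D], and [d ^ (D - 2)] has been cancelled. The two sides differ by a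
    term that vanishes at the threshold for [z], plus a positive remainder, so the inequality is
    strict even there. *)
Lemma congestion_polynomial_ineq (R : realFieldType) (y z : R) : 2 <= y -> 0 < z ->
  (8 * y ^+ 2 + 2 * y - 1) / (y - 1) <= z ->
  z - 1 + z * y < y / (y - 1) * (1 - 1 / (z * (y - 1))) * (z - 8 / (y - 1)) * y.
Proof.
move=> y_ge z_gt0; have y1_gt0 : 0 < y - 1 by lra.
rewrite ler_pdivrMr // => z_ge.
have -> : y / (y - 1) * (1 - 1 / (z * (y - 1))) * (z - 8 / (y - 1)) * y =
    z - 1 + z * y + (z * (y - 1) - (8 * y ^+ 2 + 2 * y - 1)) / (y - 1) ^+ 2
    + 8 * y ^+ 2 / (z * (y - 1) ^+ 3).
  by field; rewrite !gt_eqF.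
rewrite -[ltRHS]addrA ltrDl ltr_wpDl //.
  by rewrite divr_ge0 ?sqr_ge0 ?subr_ge0.
by rewrite divr_gt0 ?mulr_gt0 ?exprn_gt0 //; lra.
Qed.

Theorem theorem6p5 (d D : nat) (hd : (2 <= d)%N) (hD : (1 <= D)%N)
    (e : kautz d D * kautz d D) (he : kautz_edge e.1 e.2)
    (hternary : ternary (edge_word e))
    (hunb : unbordered (edge_word e))
    (hfree : plus_power_free (7 / 4) (edge_word e)) :
  [/\ (U e D)%:R >= (D%:R - Cconst d) * d%:R ^+ (D - 1) :> rat,
      (cong e)%:R >= d%:R / (d%:R - 1) * (1 - 1 / (D%:R * (d%:R - 1)))
                     * (D%:R - Cconst d) * d%:R ^+ (D - 1) :> rat
    & D%:R >= (8 * d%:R ^+ 2 + 2 * d%:R - 1) / (d%:R - 1) :> rat ->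
      (cong e > tau d D)%N].
Proof.
have U_ge_D := U_lower_bound hd hD he hunb hfree.
have d_ge : 2 <= d%:R :> rat by rewrite (ler_nat _ 2).
have D_ge1 : 1 <= D%:R :> rat by rewrite (ler_nat _ 1).
have factor_ge0 : 0 <= d%:R / (d%:R - 1) * (1 - 1 / (D%:R * (d%:R - 1))) :> rat.
  rewrite mulr_ge0 ?divr_ge0 //; try lra.
  by rewrite subr_ge0 ler_pdivrMr ?mul1r; nra.
have cong_ge_D : d%:R / (d%:R - 1) * (1 - 1 / (D%:R * (d%:R - 1)))
    * (D%:R - Cconst d) * d%:R ^+ (D - 1) <= (cong e)%:R :> rat.
  by apply: le_trans (cong_ge e hd hD); rewrite -mulrA ler_wpM2l.
split=> // D_ge; rewrite -(ltr_nat rat); apply: lt_le_trans cong_ge_D.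
(* The threshold exceeds 1, so the exponent [D - 2] is not truncated and [d ^ (D - 2)] can be
   factored out. *)
have D_gt1 : (1 < D)%N.
  rewrite -(ltr_nat rat); apply: lt_le_trans D_ge.
  have d2_ge0 : 0 <= d%:R ^+ 2 :> rat := sqr_ge0 _.
  by rewrite ltr_pdivlMr; lra.
have d_exp_gt0 : 0 < d%:R ^+ (D - 2) :> rat by rewrite exprn_gt0; lra.
have -> : (D - 1 = (D - 2).+1)%N by lia.
rewrite /tau natrD !natrM !natrX natrB // [(D - 1)%N](_ : _ = (D - 2).+1); last by lia.
rewrite exprS !mulrA -mulrDl ltr_pM2r //.
by apply: congestion_polynomial_ineq => //; lra.
Qed.
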